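(* Let $T:\mathbb{E}\rightrightarrows\mathbb{E}$ be a set-valued mapping with $\operatorname{Fix}T$ nonempty and let $\Lambda\subset\mathbb{E}$ be such that $\operatorname{Fix}T\cap\Lambda$ is closed and nonempty. For some $\delta>0$, let $T$ be almost averaged on $(\operatorname{Fix}T+\mathbb{B}_\delta)\cap\Lambda$. Let $c\in[0,1)$ and suppose that, for each $x_0\in\big((\operatorname{Fix}T+\mathbb{B}_\delta)\cap\Lambda\big)\setminus\operatorname{Fix}T$, every sequence $(x_k)_{k\in\mathbb{N}}$ generated from $x_0$ by $x_{k+1}\in Tx_k$ satisfies $Tx_k\subset\Lambda$ for all $k\in\mathbb{N}$ and is linearly monotone with respect to $\operatorname{Fix}T\cap\Lambda$ with constant $c$. Then all such sequences converge R-linearly with rate $c$ to some point in $\operatorname{Fix}T\cap\Lambda$, and $\Phi:=T-\mathrm{Id}$ is metrically subregular on $(\operatorname{Fix}T+\mathbb{B}_\delta)\setminus\operatorname{Fix}T$ for $0$ relative to $\Lambda$ with a constant $\kappa\le\frac{1}{1-c}$.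
   Context: $\mathbb{E}$ is a Euclidean space; $\mathbb{B}_\delta$ is the open ball of radius $\delta$ centered at $0$; $\operatorname{dist}(x,C):=\inf_{a\in C}\|x-a\|$. A set-valued mapping $T:\mathbb{E}\rightrightarrows\mathbb{E}$ assigns to each $x$ a nonempty subset $Tx\subset\mathbb{E}$. $\operatorname{Fix}T:=\{x: x\in Tx\}$. $\Phi(x)=\{x^+-x: x^+\in Tx\}$, $\Phi^{-1}(y)=\{x: y\in\Phi(x)\}$. The set $\Lambda$ is closed and nonempty. Almost nonexpansive: $T$ is pointwise almost nonexpansive on $\Omega$ at $y\in\Omega$ with violation $\varepsilon\ge0$ if $\|x^+-y^+\|\le\sqrt{1+\varepsilon}\,\|x-y\|$ for all $x\in\Omega$, $x^+\in Tx$, $y^+\in Ty$. Almost averaged: $T$ is almost averaged on $\Omega$ if there exist an averaging constant $\alpha\in(0,1)$ and a violation $\varepsilon\ge0$ such that $\widetilde T:=\frac1\alpha T-\frac{1-\alpha}{\alpha}\mathrm{Id}$ is pointwise almost nonexpansive on $\Omega$ at every $y\in\Omega$ with (the same) violation $\varepsilon/\alpha$. Linear monotonicity: $(x_k)$ is linearly monotone with respect to a nonempty set $S$ with constant $c\in[0,1]$ if $\operatorname{dist}(x_{k+1},S)\le c\operatorname{dist}(x_k,S)$ for all $k$. R-linear convergence: $(x_k)$ converges R-linearly to $\tilde x$ with rate $c\in[0,1)$ if there is $\gamma>0$ with $\|x_k-\tilde x\|\le\gamma c^k$ for all $k\in\mathbb{N}$. Metric subregularity: $\Phi$ is metrically subregular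 on $U$ for $y$ relative to $\Lambda$ with constant $\kappa$ if $\operatorname{dist}(x,\Phi^{-1}(y)\cap\Lambda)\le\kappa\operatorname{dist}(y,\Phi(x))$ for all $x\in U\cap\Lambda$. *)

(* Defs.v *)
From HB Require Import structures.
From mathcomp Require Import all_boot all_order all_algebra.
From mathcomp Require Import all_classical all_reals all_analysis.
Import Order.TTheory GRing.Theory Num.Theory numFieldNormedType.Exports.

Set Implicit Arguments.
Unset Strict Implicit.
Unset Printing Implicit Defensive.

Local Open Scope classical_set_scope.
Local Open Scope ring_scope.

(* Finite-dimensional real inner product spaces.  The norm (hence also the
   balls and the topology) is the one of the normed module structure, and it is
   required to be induced by the inner product.  Note that 'rV[R]_n is not an
   instance for n > 1, since its canonical norm is the sup norm. *)
HB.mixin Record NormedVector_isEuclidean (R : realType) (E : Type)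
    of NormedModule R E & Vector R E := {
  inner : {dot E for idfun} ;
  norm_inner : forall x : E, `|x| = Num.sqrt (inner x x)
}.

#[short(type="euclideanType")]
HB.structure Definition Euclidean (R : realType) :=
  {E of NormedModule R E & Vector R E & NormedVector_isEuclidean R E}.

Section Definitions.
Context {R : realType} {E : euclideanType R}.
Implicit Types (T Phi : E -> set E) (C S U Lambda Omega : set E).
Implicit Types (x y : E) (u : nat -> E).

(* Extended-real valued, so that the distance to the empty set is +oo. *)
Definition dist x C : \bar R := ereal_inf [set `|x - a|%:E | a in C].

Definition Fix T : set E := [set x | T x x].

Definition displacement T : E -> set E := fun x => [set x' - x | x' in T x].

Definition setinv Phi : E -> set E := fun y => [set x | Phi x y].

(* The Minkowski sum C + B_delta with the open ball centered at 0. *)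
Definition enlargement C (delta : R) : set E :=
  [set a + b | a in C & b in ball (0 : E) delta].

Definition almost_nonexpansive_at T Omega y (eps : R) : Prop :=
  forall x x' y', Omega x -> T x x' -> T y y' ->
    `|x' - y'| <= Num.sqrt (1 + eps) * `|x - y|.

(* alpha^-1 T - ((1 - alpha) / alpha) Id *)
Definition relaxation T (alpha : R) : E -> set E :=
  fun x => [set alpha^-1 *: x' - ((1 - alpha) / alpha) *: x | x' in T x].

Definition almost_averaged T Omega : Prop :=
  exists alpha eps : R, [/\ 0 < alpha < 1, 0 <= eps &
    forall y, Omega y ->
      almost_nonexpansive_at (relaxation T alpha) Omega y (eps / alpha)].

Definition generated_from T x u : Prop :=
  u 0%N = x /\ forall k, T (u k) (u k.+1).

Definition linearly_monotone u S (c : R) : Prop :=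
  forall k, (dist (u k.+1) S <= c%:E * dist (u k) S)%E.

Definition R_linear_cvg u x (c : R) : Prop :=
  exists2 gamma : R, 0 < gamma & forall k, `|u k - x| <= gamma * c ^+ k.

Definition metrically_subregular Phi U y Lambda (kappa : R) : Prop :=
  forall x, (U `&` Lambda) x ->
    (dist x (setinv Phi y `&` Lambda) <= kappa%:E * dist y (Phi x))%E.

End Definitions.

(* Main.v *)
Require Import Defs.
From mathcomp Require Import all_boot all_order all_algebra.
From mathcomp Require Import all_classical all_reals all_analysis.
From mathcomp Require Import ring.
Import Order.TTheory GRing.Theory Num.Theory numFieldNormedType.Exports.
Local Open Scope classical_set_scope.
Local Open Scope ring_scope.

(** Write [S] for the fixed points in [Lambda], a closed set, and [Omega] for
the part of the enlargement of the fixed point set that lies in [Lambda].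

The averaging property enters only through one estimate, [averaged_step]: if
[x] is in [Omega] and [x'] in [T x], comparing [x] with an arbitrary fixed point
[y] in [S] gives [|x' - x| <= C |x - y|], since [y] is one of its own images;
taking the infimum over [y], the step [|x' - x|] is at most [C] times the
distance from [x] to [S].  Linear monotonicity makes that distance decay like
[c ^+ k] along an orbit, so the steps of the orbit are dominated by a geometric
series.  Such an orbit is Cauchy, its limit [x] satisfies
[|u k - x| <= gamma c ^+ k], and [x] is in the closed set [S] because its
distance to [S] vanishes.

The starting point is close to some fixed point, but possibly not to one in
[Lambda], so the first iterates may leave [Omega] and escape the step estimate.
Only finitely many of them are concerned, namely those at distance at least
[delta] from [S], and for these the ratio of the step to the distance is finite:
enlarging the constant absorbs them ([linearly_monotone_R_linear]).

Existence of the limit needs completeness of the space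
([euclidean_complete]).  It follows from that of the reals because the
coordinates in a basis are bounded linear forms: by invertibility of the Gram
matrix of the basis they are combinations of inner products with the basis
vectors.

Metric subregularity is the triangle inequality: for [x'] in [T x], an orbit
starting with [x, x'] exists since [T] has nonempty values, so
[dist x S <= |x - x'| + dist x' S <= |x - x'| + c * dist x S]. *)

(** * Completeness of Euclidean spaces *)

Section Euclidean.
Context {R : realType} {E : euclideanType R}.
Implicit Types x y : E.

Lemma innerC x y : inner x y = inner y x.
Proof. by rewrite hermC /= expr0 mul1r. Qed.

Lemma innerZl (a : R) x y : inner (a *: x) y = a * inner x y.
Proof. exact: linearZl_LR. Qed.

Lemma innerZr (a : R) x y : inner x (a *: y) = a * inner x y.
Proof. by rewrite innerC innerZl innerC. Qed.

Lemma inner_ge0 x : 0 <= inner x x.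
Proof.
have [->|x0] := eqVneq x 0; first by rewrite linear0r.
exact/ltW/neq0_dnorm_gt0.
Qed.

Lemma inner_norm x : inner x x = `|x| ^+ 2.
Proof. by rewrite norm_inner sqr_sqrtr// inner_ge0. Qed.

(** Cauchy-Schwarz for a real inner product. *)
Lemma normr_inner_le x y : `|inner x y| <= `|x| * `|y|.
Proof.
have [->|y0] := eqVneq y 0; first by rewrite linear0r !normr0 mulr0.
have y2 : 0 < `|y| ^+ 2 by rewrite exprn_gt0// normr_gt0.
(* [z] is the component of [x] orthogonal to [y], scaled by [`|y| ^+ 2]. *)
set z := `|y| ^+ 2 *: x - inner x y *: y.
have : 0 <= inner z z by exact: inner_ge0.
have -> : inner z z = `|y| ^+ 2 * (`|x| ^+ 2 * `|y| ^+ 2 - inner x y ^+ 2).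
  rewrite /z linearBl /= !linearBr /= !innerZl !innerZr (innerC y x) !inner_norm.
  by ring.
rewrite pmulr_rge0// subr_ge0 -exprMn -[X in X <= _]real_normK ?num_real//.
by rewrite ler_sqr// nnegrE// mulr_ge0.
Qed.

(** The coordinate row [v] of [x] satisfies [v *m G = (inner x e_k)_k] for the
Gram matrix [G], which is invertible because the inner product is definite;
hence each coordinate of [x] is a fixed combination of the [inner x e_k]. *)
Lemma coord_bounded {n} {e : n.-tuple E} (i : 'I_n) :
  basis_of fullv e -> exists2 C : R, 0 < C & forall x, `|coord e i x| <= C * `|x|.
Proof.
move=> eb; have fe := basis_free eb.
pose G : 'M[R]_n := \matrix_(i, j) inner e`_i e`_j.
have coordE x : x = \sum_j coord e j x *: e`_j.
  by apply: coord_basis eb _; rewrite memvf.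
have innerG (v : 'rV[R]_n) (j : 'I_n) : inner (\sum_i v 0 i *: e`_i) e`_j = (v *m G) 0 j.
  rewrite linear_sumlz mxE; apply: eq_bigr => k _.
  by rewrite mxE; exact: innerZl.
have Gfree : row_free G.
  apply: inj_row_free => v vG0.
  pose w := \sum_i v 0 i *: e`_i.
  have w0 : w = 0.
    apply/eqP; rewrite -normr_eq0 -sqrf_eq0 -inner_norm {2}/w linear_sumr /=.
    rewrite big1// => j _; rewrite innerZr.
    by rewrite innerG vG0 mxE mulr0.
  apply/rowP => k; rewrite mxE.
  by have /freeP := fe; apply; exact: w0.
have coordG x : coord e i x = \sum_(k < n) inner x e`_k * invmx G k i.
  pose v : 'rV[R]_n := \row_j coord e j x.
  have -> : coord e i x = (v *m G *m invmx G) 0 i.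
    by rewrite mulmxK -?row_free_unit// mxE.
  rewrite mxE; apply: eq_bigr => k _; rewrite -innerG; congr (inner _ _ * _).
  rewrite [in RHS](coordE x); by apply: eq_bigr => l _; rewrite mxE.
(* The summand 1 only makes the constant positive. *)
exists (1 + \sum_(k < n) `|e`_k| * `|invmx G k i|).
  by rewrite ltr_pwDl// sumr_ge0// => k _; rewrite mulr_ge0.
move=> x; rewrite coordG mulrDl mul1r (le_trans (ler_norm_sum _ _ _))//.
rewrite -[X in X <= _]add0r lerD// mulr_suml ler_sum// => k _.
by rewrite normrM mulrAC ler_wpM2r// mulrC normr_inner_le.
Qed.

(** Bounded coordinates turn a Cauchy filter into Cauchy filters of reals, and
the limits of the coordinates are the coordinates of the limit. *)
Lemma euclidean_complete (F : set_system E) {FF : ProperFilter F} :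
  cauchy F -> cvg F.
Proof.
move=> /cauchyP Fc.
pose e := vbasis (@fullv R E).
have eb : basis_of fullv e by exact: vbasisP.
have /choice[a aP] : forall i, exists a : R, coord e i @ F --> a.
  move=> i; have [C C0 leC] := coord_bounded i eb.
  apply/cvg_ex/cauchy_cvgP/cauchyP => r r0.
  have [x Fx] := Fc (r / C) (divr_gt0 r0 C0).
  exists (coord e i x); rewrite /fmap/=; apply: filterS Fx => y.
  rewrite /preimage -!ball_normE /= => xy; rewrite -linearB.
  by rewrite (le_lt_trans (leC _))// mulrC -ltr_pdivlMr.
apply/cvg_ex; exists (\sum_i a i *: e`_i).
have coordE x : x = \sum_i coord e i x *: e`_i.
  by apply: coord_vbasis; rewrite memvf.
suff : (fun x => \sum_i coord e i x *: e`_i) @ F --> \sum_i a i *: e`_i.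
  by rewrite (_ : (fun x => _) = id)//; apply/funext => x; rewrite -coordE.
by apply: cvg_big => [|i _]; [exact: add_continuous|exact: cvgZr_tmp].
Qed.

Lemma geometric_steps_cvg {u : nat -> E} {c M : R} : 0 <= c < 1 ->
  (forall k, `|u k.+1 - u k| <= M * c ^+ k) ->
  exists x, forall k, `|u k - x| <= M / (1 - c) * c ^+ k.
Proof.
move=> /andP[c0 c1] step.
have c1' : 0 < 1 - c by rewrite subr_gt0.
have M0 : 0 <= M by have := le_trans (normr_ge0 _) (step 0); rewrite mulr1.
(* The exact geometric partial sum, so that the induction closes. *)
have tail k j : `|u k - u (k + j)%N| <= M / (1 - c) * (c ^+ k - c ^+ (k + j)).
  elim: j => [|j IH]; first by rewrite addn0 !subrr normr0 mulr0.
  rewrite addnS; apply: le_trans (ler_distD (u (k + j)%N) _ _) _.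
  rewrite (distrC (u (k + j)%N)); apply: le_trans (lerD IH (step _)) _.
  rewrite exprS le_eqVlt; apply/orP; left; apply/eqP; field.
  by rewrite gt_eqF.
have tail' k j : (k <= j)%N -> `|u k - u j| <= M / (1 - c) * c ^+ k.
  move=> kj; rewrite -(subnKC kj); apply: le_trans (tail _ _) _.
  by rewrite ler_wpM2l ?divr_ge0 ?(ltW c1')// gerBl exprn_ge0.
have : cauchy (u @ \oo).
  apply: cauchy_exP => r r0.
  have : M / (1 - c) * c ^+ n @[n --> \oo] --> 0.
    by apply: cvg_geometric; rewrite ger0_norm.
  move=> /cvgr0Pnorm_lt /(_ _ r0) [N _ /(_ N (leqnn _)) /= HN].
  exists (u N); exists N => // m /= Nm; rewrite -ball_normE /=.
  by apply: le_lt_trans (tail' _ _ Nm) _; rewrite (le_lt_trans (ler_norm _)).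
move=> /euclidean_complete/cvg_ex[x ux]; exists x => k.
have uxk : `|u k - u n| @[n --> \oo] --> `|u k - x|.
  by apply: cvg_norm; apply: cvgB => //; exact: cvg_cst.
apply: (closed_cvg [set z | z <= M / (1 - c) * c ^+ k]) uxk.
  exact: closed_le.
by exists k => // n /= kn; exact: tail'.
Qed.

End Euclidean.

(** * Distance to a set *)

Section Distance.
Context {R : realType} {E : euclideanType R}.
Implicit Types (x y a : E) (C : set E).

Lemma dist_le_norm {x a C} : C a -> (dist x C <= `|x - a|%:E)%E.
Proof. by move=> Ca; apply: ereal_inf_lbound; exists a. Qed.

Lemma dist_fin_num {x C} : C !=set0 -> dist x C \is a fin_num.
Proof.
move=> [a Ca]; rewrite ge0_fin_numE.
  exact: le_lt_trans (dist_le_norm Ca) (ltry _).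
by apply: le_ereal_inf_tmp => _ [b _ <-]; rewrite lee_fin.
Qed.

Lemma dist_ge0 x C : (0 <= dist x C)%E.
Proof. by apply: le_ereal_inf_tmp => _ [b _ <-]; rewrite lee_fin. Qed.

Lemma dist_lt_ex {x C} {r : R} : (dist x C < r%:E)%E ->
  exists2 a, C a & `|x - a| < r.
Proof. by move=> /ereal_inf_lt[_ [a Ca <-]]; rewrite lte_fin; exists a. Qed.

(** The way to bound a real number by a multiple of an infimum without leaving
real arithmetic for the points of the set. *)
Lemma le_scaled_dist {x C} {k d : R} : 0 < k ->
  (forall a, C a -> d <= k * `|x - a|) -> (d%:E <= k%:E * dist x C)%E.
Proof.
move=> k0 H; rewrite -lee_pdivrMl//; apply: le_ereal_inf_tmp => _ [a Ca <-].
by rewrite -EFinM lee_fin mulrC ler_pdivrMr// mulrC H.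
Qed.

Lemma dist_triangle x y C : (dist x C <= `|x - y|%:E + dist y C)%E.
Proof.
rewrite -leeBlDl//; apply: le_ereal_inf_tmp => _ [a Ca <-].
rewrite leeBlDl// -EFinD.
by apply: le_trans (dist_le_norm Ca) _; rewrite lee_fin ler_distD.
Qed.

Lemma closed_dist_le0 {x C} : closed C -> (dist x C <= 0)%E -> C x.
Proof.
move=> cC x0; apply: cC => B /nbhs_ballP[r /= r0 rB].
have [|a Ca xa] := @dist_lt_ex x C r; first exact: le_lt_trans x0 _.
by exists a; split => //; apply: rB; rewrite -ball_normE.
Qed.

End Distance.

(** * Almost averaged mappings and linearly monotone sequences *)

Section Main.
Context {R : realType} {E : euclideanType R}.
Implicit Types (T : E -> set E) (S Omega : set E) (u : nat -> E).

(** A fixed point [y] is its own image under [T] and under the relaxation [z] of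
[T], hence [|z - y| <= L |x - y|], and the step [x' - x] is [alpha] times
[z - x]. *)
Lemma averaged_step {T Omega} : almost_averaged T Omega ->
  exists2 C : R, 0 < C & forall S x x', S `<=` Fix T `&` Omega ->
    Omega x -> T x x' -> (`|x' - x|%:E <= C%:E * dist x S)%E.
Proof.
move=> [alpha [eps [/andP[a0 a1] e0 H]]].
set L := Num.sqrt (1 + eps / alpha) in H.
have C0 : 0 < alpha * (L + 1) by rewrite mulr_gt0// ltr_wpDl ?sqrtr_ge0.
exists (alpha * (L + 1)) => // S x x' SO Ox Tx; apply: le_scaled_dist => // y /SO[Fy Oy].
pose z := alpha^-1 *: x' - ((1 - alpha) / alpha) *: x.
have zy : `|z - y| <= L * `|x - y|.
  apply: H => //; first by exists x'.
  exists y => //; rewrite -scalerBl mulrBl mul1r divff ?gt_eqF//.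
  by rewrite opprB addrC subrK scale1r.
have -> : x' - x = alpha *: (z - x).
  rewrite /z !scalerBr !scalerA mulrCA divff ?gt_eqF// mulr1 scale1r scalerBl.
  by rewrite scale1r opprB [in RHS](addrC (alpha *: x)) addrA addrK.
rewrite normrZ gtr0_norm// -mulrA ler_wpM2l ?(ltW a0)//.
rewrite mulrDl mul1r (le_trans (ler_distD y _ _))//.
by rewrite lerD// distrC.
Qed.

Lemma linearly_monotone_geometric {u S} {c : R} : 0 <= c -> S !=set0 ->
  linearly_monotone u S c -> forall k, (dist (u k) S <= (fine (dist (u 0) S) * c ^+ k)%:E)%E.
Proof.
move=> c0 S0 mono; elim=> [|k IH]; first by rewrite mulr1 fineK// dist_fin_num.
apply: le_trans (mono k) _; rewrite exprS mulrCA EFinM.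
by rewrite lee_wpmul2l// lee_fin.
Qed.

(** The estimate of the steps is only required at distance less than [r] from
[S]; the distances tend to 0, so finitely many steps are not covered. *)
Lemma linearly_monotone_R_linear {u S} {c C r : R} : closed S -> S !=set0 ->
  0 <= c < 1 -> 0 < C -> 0 < r -> linearly_monotone u S c ->
  (forall k, (dist (u k) S < r%:E)%E -> (`|u k.+1 - u k|%:E <= C%:E * dist (u k) S)%E) ->
  exists2 x, S x & R_linear_cvg u x c.
Proof.
move=> Scl S0 /andP[c0 c1] C0 r0 mono stepC.
have geo := linearly_monotone_geometric c0 S0 mono.
set d0 := fine _ in geo.
have d00 : 0 <= d0 by rewrite fine_ge0// dist_ge0.
have cvg0 (a : R) : a * c ^+ k @[k --> \oo] --> 0.
  by apply: cvg_geometric; rewrite ger0_norm.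
have /cvgr0Pnorm_lt /(_ _ r0) [N _ HN] := cvg0 d0.
(* A step that is not covered starts at distance at least [r] from [S], so it is
   at most [`|step| / r] times this distance.  Comparing with the distance, not
   with [c ^+ k], is what makes [c = 0] an ordinary case. *)
pose M := C + \sum_(k < N) `|u k.+1 - u k| / r.
have M0 : 0 <= M by rewrite addr_ge0 ?(ltW C0)// sumr_ge0// => k _; rewrite divr_ge0// ltW.
have step k : `|u k.+1 - u k| <= M * d0 * c ^+ k.
  rewrite -mulrA.
  suff : (`|u k.+1 - u k|%:E <= M%:E * dist (u k) S)%E.
    move=> /le_trans/(_ (lee_wpmul2l _ (geo k))); rewrite -EFinM !lee_fin.
    exact.
  have [near_S|far] := ltP (dist (u k) S) r%:E.
    apply: le_trans (stepC _ near_S) _; rewrite lee_wpmul2r ?dist_ge0//.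
    rewrite lee_fin lerDl sumr_ge0// => i _; by rewrite divr_ge0// ltW.
  have kN : (k < N)%N.
    rewrite ltnNge; apply/negP => Nk; have := HN k Nk; rewrite /=.
    have := le_trans far (geo k); rewrite lee_fin => rd.
    by rewrite ltNge (le_trans rd)// ler_norm.
  apply: (@le_trans _ _ (M%:E * r%:E)%E); last by rewrite lee_wpmul2l.
  rewrite -EFinM lee_fin -ler_pdivrMr// /M (bigD1 (Ordinal kN))//= addrCA lerDl.
  rewrite addr_ge0 ?(ltW C0)// sumr_ge0// => i _; by rewrite divr_ge0// ltW.
have c01 : 0 <= c < 1 by rewrite c0.
have [x ux] := geometric_steps_cvg c01 step.
have g0 : 0 <= M * d0 / (1 - c).
  by rewrite !mulr_ge0// invr_ge0 subr_ge0 ltW.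
exists x; last first.
  (* The summand 1 keeps the constant positive when [d0 = 0]. *)
  exists (1 + M * d0 / (1 - c)); first by rewrite ltr_pwDl.
  move=> k; apply: le_trans (ux k) _.
  by rewrite ler_wpM2r ?exprn_ge0// lerDr.
apply: closed_dist_le0 => //.
have xk k : fine (dist x S) <= (M * d0 / (1 - c) + d0) * c ^+ k.
  rewrite -lee_fin fineK ?dist_fin_num// (le_trans (dist_triangle x (u k) S))//.
  by rewrite mulrDl EFinD leeD// lee_fin distrC.
rewrite -(fineK (dist_fin_num S0)) lee_fin.
have := cvg0 (M * d0 / (1 - c) + d0).
apply: (closed_cvg [set z | fine (dist x S) <= z]); first exact: closed_ge.
exact: nearW.
Qed.

Lemma enlargement_dist {S1 S2} {r : R} {x : E} : S1 `<=` S2 ->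
  (dist x S1 < r%:E)%E -> enlargement S2 r x.
Proof.
move=> S12 /dist_lt_ex[a /S12 Sa xa]; exists a => //; exists (x - a).
  by rewrite -ball_normE /= sub0r normrN.
by rewrite addrC subrK.
Qed.

Lemma generated_from_ex {T} {x x' : E} : (forall x, T x !=set0) -> T x x' ->
  exists2 u, generated_from T x u & u 1 = x'.
Proof.
move=> T0 Txx'.
have [v [v0 vS]] := dependent_choice (fun y => cid (T0 y)) x'.
exists (fun k => if k is j.+1 then v j else x) => //.
by split=> // -[|k] //=; rewrite v0.
Qed.

Lemma setinv_displacement T : setinv (displacement T) 0 = Fix T.
Proof.
apply/seteqP; split => x /=; last by move=> Tx; exists x => //; rewrite subrr.
by move=> [x' Tx' /subr0_eq xx']; rewrite xx' in Tx'.
Qed.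

End Main.

Theorem corollary3p13 (R : realType) (E : euclideanType R)
    (T : E -> set E) (Lambda : set E) (delta c : R)
    (T_neq0 : forall x, T x !=set0)
    (FixT_neq0 : Fix T !=set0)
    (FixTL_closed : closed (Fix T `&` Lambda))
    (FixTL_neq0 : Fix T `&` Lambda !=set0)
    (delta_gt0 : 0 < delta)
    (T_averaged : almost_averaged T (enlargement (Fix T) delta `&` Lambda))
    (c_ge0_lt1 : 0 <= c < 1)
    (T_monotone : forall (x0 : E) (u : nat -> E),
       ((enlargement (Fix T) delta `&` Lambda) `\` Fix T) x0 ->
       generated_from T x0 u ->
       (forall k, T (u k) `<=` Lambda) /\
       linearly_monotone u (Fix T `&` Lambda) c) :
  (forall (x0 : E) (u : nat -> E),
     ((enlargement (Fix T) delta `&` Lambda) `\` Fix T) x0 ->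
     generated_from T x0 u ->
     exists2 x : E, (Fix T `&` Lambda) x & R_linear_cvg u x c) /\
  (exists2 kappa : R, kappa <= 1 / (1 - c) &
     metrically_subregular (displacement T)
       (enlargement (Fix T) delta `\` Fix T) 0 Lambda kappa).
Proof.
have [c0 c1] := andP c_ge0_lt1.
have c1' : 0 < 1 - c by rewrite subr_gt0.
set S := Fix T `&` Lambda in FixTL_closed FixTL_neq0 T_monotone *.
set Omega := enlargement (Fix T) delta `&` Lambda in T_averaged T_monotone *.
have S_Omega : S `<=` Fix T `&` Omega.
  move=> y [Fy Ly]; split=> //; split=> //; exists y => //.
  by exists 0; [exact: ballxx|rewrite addr0].
split=> [x0 u x0O ugen|].
  have [TL mono] := T_monotone _ _ x0O ugen.
  have [C C0 stepC] := averaged_step T_averaged.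
  apply: (linearly_monotone_R_linear FixTL_closed FixTL_neq0 _ C0 delta_gt0 mono).
    by rewrite c0.
  move=> k near_S; apply: stepC => //; last exact: ugen.2.
  split; first by apply: enlargement_dist near_S => y [].
  case: k {near_S} => [|k]; first by rewrite ugen.1; case: x0O => -[].
  exact: (TL k _ (ugen.2 k)).
exists (1 / (1 - c)) => // x [[Ux nFx] Lx].
rewrite setinv_displacement -/S -(fineK (dist_fin_num FixTL_neq0)).
apply: le_scaled_dist; first by rewrite divr_gt0.
move=> _ [x' Tx' <-]; rewrite sub0r normrN div1r mulrC ler_pdivlMr//.
have [u ugen u1] := generated_from_ex T_neq0 Tx'.
have [_ /(_ 0%N)] := T_monotone x u (conj (conj Ux Lx) nFx) ugen.
rewrite u1 ugen.1 => x'S.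
have := le_trans (dist_triangle x x' S) (leeD2l _ x'S).
rewrite -(fineK (dist_fin_num (x := x) FixTL_neq0)) -EFinM -EFinD lee_fin distrC /=.
by rewrite mulrBr mulr1 lerBlDr [X in _ + X]mulrC.
Qed.
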